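(* Let $d\ge1$ and let $K_d>0$ be a constant depending on $d$. Then there exists a real number $\theta$ such that, setting $a_k:=\theta\cdot k!$ for $k\ge0$, the following holds: for every $\eta>0$ there is a constant $C>0$ (independent of $V$, $\bm{m}$, $\bm{q}$) such that for every integer $V\ge1$, every $\bm{m}\in\{0,1,\dots,\lfloor K_dV\rfloor\}^d\setminus\{\bm{0}\}$ and every $\bm{q}\in D_1^{(d)}(V)$, $$\Big|\sum_{k=V+1}^{2V}\mathrm{e}\big(\bm{m}\cdot(k\bm{q}-a_k\mathbb{1}_d)\big)\Big|\le C\,V^{1/2+\eta}.$$
   Context: $\mathrm{e}(x):=\exp(2i\pi x)$, $\mathbb{1}_d=(1,\dots,1)\in\mathbb{R}^d$, $\bm{x}\cdot\bm{y}$ is the usual dot product. $D_1^{(d)}(V):=\{\bm{q}\in[-1,1]^d\cap\mathbb{Q}^d:\mathrm{den}(\bm{q})\le V^2\}$, where for $\bm{q}=\bm{a}/b$ with $\bm{a}\in\mathbb{Z}^d$, $b\in\mathbb{N}$, $\gcd(\bm{a},b)=1$, $\mathrm{den}(\bm{q}):=b$. *)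

(* Defs.v *)
From HB Require Import structures.
From mathcomp Require Import all_boot all_order all_algebra.
From mathcomp Require Import complex.
From mathcomp Require Import boolp classical_sets reals sequences exp trigo.

Set Implicit Arguments.
Unset Strict Implicit.
Unset Printing Implicit Defensive.

Import Order.TTheory GRing.Theory Num.Theory.

Local Open Scope ring_scope.
Local Open Scope complex_scope.

Definition expC (R : realType) (z : R[i]) : R[i] :=
  (expR (complex.Re z))%:C * (cos (complex.Im z) +i* sin (complex.Im z)).

Definition e (R : realType) (x : R) : R[i] := expC ((2 * pi * x) *i).

Definition dot (R : realType) (d : nat) (x y : 'rV[R]_d) : R :=
  \sum_(i < d) x 0 i * y 0 i.

Definition reduced_fraction (d : nat) (q : 'rV[rat]_d) (a : 'rV[int]_d)
    (b : nat) : Prop :=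
  [/\ (0 < b)%N,
      gcdn (\big[gcdn/0%N]_(i < d) `|a 0%R i|%N) b = 1%N &
      forall i, q 0 i = (a 0 i)%:~R / b%:R].

(* The default value 0 is never used: see denP and den_unique. *)
Definition den (d : nat) (q : 'rV[rat]_d) : nat :=
  xget 0%N [set b | exists a, reduced_fraction q a b]%classic.

Definition D1 (d V : nat) : set 'rV[rat]_d :=
  [set q : 'rV[rat]_d | (forall i, -1 <= q 0 i <= 1) /\ (den q <= V ^ 2)%N]%classic.

Lemma reduced_fraction_ex (d : nat) (q : 'rV[rat]_d) :
  exists b a, reduced_fraction q a b.
Proof.
pose P b := (0 < b)%N && [forall i : 'I_d, q 0 i * b%:R \is a Num.int].
have exP : exists b, P b.
  exists (\prod_(i < d) `|denq (q 0%R i)|)%N; apply/andP; split.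
    by rewrite prodn_gt0// => i; rewrite absz_gt0 denq_neq0.
  apply/forallP => i; rewrite (bigD1 i)//= natrM mulrA rpredM ?natr_int//.
  rewrite pmulrn absz_denq -[q 0 i]divq_num_den.
  by rewrite divq_num_den -numqE intr_int.
case: (ex_minnP exP) => b /andP[b0 /forallP qb] bmin.
pose a : 'rV[int]_d := \row_i Num.floor (q 0 i * b%:R).
have aE i : (a 0 i)%:~R = q 0 i * b%:R by rewrite mxE floorK.
have bN0 : b%:R != 0 :> rat by rewrite pnatr_eq0 -lt0n.
exists b, a; split => //; last by move=> i; rewrite aE mulfK.
set g := gcdn _ _.
have g0 : (0 < g)%N by rewrite gcdn_gt0 b0 orbT.
have gb : (g %| b)%N by exact: dvdn_gcdr.
have ga i : (g %| `|a 0%R i|)%N.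
  by apply: dvdn_trans (dvdn_gcdl _ _) _; rewrite (bigD1 i)//= dvdn_gcdl.
have gN0 : g%:R != 0 :> rat by rewrite pnatr_eq0 -lt0n.
have Pbg : P (b %/ g)%N.
  rewrite /P divn_gt0// dvdn_leq//=; apply/forallP => i.
  have /dvdzP[c ac] : (g%:Z %| a 0%R i)%Z by rewrite dvdzE.
  suff -> : q 0 i * (b %/ g)%:R = c%:~R by exact: intr_int.
  apply: (mulIf gN0); rewrite -mulrA -natrM divnK// -aE ac intrM.
  by rewrite pmulrn.
have := bmin _ Pbg; rewrite leq_divRL// => h.
apply/eqP; rewrite eqn_leq g0 andbT.
by rewrite -(leq_pmul2l b0) muln1.
Qed.

Lemma reduced_fraction_unique (d : nat) (q : 'rV[rat]_d) a a' b b' :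
  reduced_fraction q a b -> reduced_fraction q a' b' -> b = b'.
Proof.
suff dv a1 a2 b1 b2 :
    reduced_fraction q a1 b1 -> reduced_fraction q a2 b2 -> (b1 %| b2)%N.
  by move=> h h'; apply/eqP; rewrite eqn_dvd (dv _ _ _ _ h h') (dv _ _ _ _ h' h).
move=> [b1_gt0 g1 q1] [b2_gt0 _ q2].
rewrite -[b2]muln1 -g1 muln_gcdr dvdn_gcd; apply/andP; split; last exact: dvdn_mull.
apply: (big_ind (fun n => b1 %| b2 * n)%N) => [|m n hm hn|i _].
- by rewrite muln0.
- by rewrite muln_gcdr dvdn_gcd hm hn.
have b1N0 : b1%:R != 0 :> rat by rewrite pnatr_eq0 -lt0n.
have b2N0 : b2%:R != 0 :> rat by rewrite pnatr_eq0 -lt0n.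
have : a1 0 i * b2%:Z = a2 0 i * b1%:Z.
  apply: (@intr_inj rat); rewrite !intrM -!pmulrn; apply/eqP.
  by rewrite -eqr_div// -q1 -q2.
move/(congr1 absz); rewrite !abszM/= [(b2 * _)%N]mulnC => ->.
exact: dvdn_mull.
Qed.

Lemma denP (d : nat) (q : 'rV[rat]_d) : exists a, reduced_fraction q a (den q).
Proof.
have [b [a h]] := reduced_fraction_ex q.
by rewrite /den; case: xgetP => [c _ //|/(_ b)]; case; exists a.
Qed.

Lemma den_unique (d : nat) (q : 'rV[rat]_d) a b :
  reduced_fraction q a b -> den q = b.
Proof. by have [a' h'] := denP q => /(reduced_fraction_unique h'). Qed.

(* Main.v *)
Require Import Defs.
From HB Require Import structures.
From mathcomp Require Import all_boot all_order all_algebra.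
From mathcomp Require Import complex.
From mathcomp Require Import boolp classical_sets reals sequences exp trigo.
From mathcomp Require Import topology normedtype realfun.
From mathcomp Require Import ring lra.

(** Write [M] for the sum of the entries of [m]: the sum to bound is
    [S(theta) = \sum_k e (k * alpha - M * theta * k!)], where [alpha = m . q] has
    denominator at most [V ^ 2], so that modulo 1 only [V ^ 4] values of
    [alpha] occur. Averaged over [theta = j / N] with [N] large, [|S|^(2p)]
    counts the solutions of [\sum_i k_i! = \sum_i l_i!] in [p]-tuples of
    integers of (V, 2V]. For [p <= V], uniqueness of digits in the factorial
    number system forces the two tuples to take the same values, whence a mean
    value of at most [p ^ p * V ^ p]. Let [p] grow with [V] so slowly that
    [p ^ p <= V]. By Markov's inequality, for each [T] some [theta] in [0, 1]
    satisfies [|S|^(2p) = O(V^(p + 8))] for all [V <= T] and all [M], [alpha];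
    a cluster point of these [theta]'s as [T] grows works for all [V], and
    taking [2p]-th roots gives the exponent [1/2 + 4/p]. *)

Set Implicit Arguments.
Unset Strict Implicit.

Import Order.TTheory GRing.Theory Num.Theory.
Import numFieldNormedType.Exports.

(** * Factorial digits and equal sums of factorials *)

Lemma dvdn_sum_fact n s (c : nat -> nat) :
  (s`! %| \sum_(v < n) c v * (s + v)`!)%N.
Proof. apply: dvdn_sum => v _; rewrite dvdn_mull//.
by rewrite (@fact_split (s + v) s) ?leq_addr// dvdn_mulr. Qed.

(** Terms with [v] positive are multiples of [(s + 1)!], so dividing by [s!] and reducing modulo
    [s + 1] isolates [c 0] and [d 0]. Induction on [n], with [s] increased by one, treats the other
    digits. *)
Lemma factorial_digits_inj n s (c d : nat -> nat) :
    (forall v, c v <= s) -> (forall v, d v <= s) ->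
    \sum_(v < n) c v * (s + v)`! = \sum_(v < n) d v * (s + v)`! ->
  forall v, v < n -> c v = d v.
Proof.
elim: n s c d => [//|n IHn] s c d cs ds.
rewrite !big_ord_recl/= addn0.
have shift (f : nat -> nat) : \sum_(i < n) f (bump 0 i) * (s + bump 0 i)`!
    = \sum_(i < n) f i.+1 * (s.+1 + i)`!.
  by apply: eq_bigr => i _; rewrite /bump/= add1n addnS.
rewrite !shift => E.
have [x xE] := dvdnP (dvdn_sum_fact n s.+1 (fun i => c i.+1)).
have [y yE] := dvdnP (dvdn_sum_fact n s.+1 (fun i => d i.+1)).
have E0 : c 0 = d 0.
  have : x * s.+1 + c 0 = y * s.+1 + d 0.
    apply/eqP; rewrite -(eqn_pmul2r (fact_gt0 s)) !mulnDl -!mulnA -factS.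
    by rewrite -xE -yE ![_ + _ * s`!]addnC E.
  move/(congr1 (modn^~ s.+1)); rewrite !modnMDl.
  by rewrite !modn_small ?ltnS.
case=> // v; rewrite ltnS => vn.
apply: (IHn s.+1 (fun i => c i.+1) (fun i => d i.+1)) => //; try by move=> i; exact: leqW.
by move/eqP: E; rewrite E0 eqn_add2l => /eqP.
Qed.

(** The multiplicities of the values of [f] will serve as factorial digits. *)
Lemma sum_by_fiber p V (f : {ffun 'I_p -> 'I_V}) (F : nat -> nat) :
  \sum_i F (f i) = \sum_(v < V) #|[pred i | f i == v :> nat]| * F v.
Proof.
rewrite (partition_big f predT)//=; apply: eq_bigr => v _.
by rewrite (eq_bigr (fun=> F v)) => [|i /eqP->//]; rewrite sum_nat_const.
Qed.

(** Multiplicities are at most [p <= V], hence admissible digits, and so are determined by the sum: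
    a value taken by [g] has positive multiplicity for [f] too. *)
Lemma factorial_sum_codom p V (f g : {ffun 'I_p -> 'I_V}) : p <= V ->
    \sum_i (V.+1 + f i)`! = \sum_i (V.+1 + g i)`! ->
  forall i, exists j, g i = f j.
Proof.
move=> pV; rewrite (sum_by_fiber f (fun v => (V.+1 + v)`!)).
rewrite (sum_by_fiber g (fun v => (V.+1 + v)`!)) => E i.
have bnd (h : {ffun 'I_p -> 'I_V}) v : #|[pred i | h i == v :> nat]| <= V.+1.
  by rewrite (leq_trans (max_card _))// card_ord leqW.
have /= H := factorial_digits_inj (bnd f) (bnd g) E (ltn_ord (g i)).
have : 0 < #|[pred j | f j == g i :> nat]|.
  by rewrite H; apply/card_gt0P; exists i; rewrite inE.
by case/card_gt0P => j; rewrite inE => /eqP ji; exists j; apply/val_inj.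
Qed.

(** In a solution, [g] is [f] composed with a self-map of the indices: there are [V ^ p] choices of
    [f] and [p ^ p] of the map. *)
Lemma card_factorial_sum p V : p <= V ->
  #|[pred u : {ffun 'I_p -> 'I_V} * {ffun 'I_p -> 'I_V} |
      \sum_i (V.+1 + u.1 i)`! == \sum_i (V.+1 + u.2 i)`!]| <= p ^ p * V ^ p.
Proof.
move=> pV.
pose F (w : {ffun 'I_p -> 'I_V} * {ffun 'I_p -> 'I_p}) :
  {ffun 'I_p -> 'I_V} * {ffun 'I_p -> 'I_V} := (w.1, [ffun i => w.1 (w.2 i)]).
have -> : p ^ p * V ^ p = #|{: {ffun 'I_p -> 'I_V} * {ffun 'I_p -> 'I_p}}|.
  by rewrite card_prod !card_ffun !card_ord mulnC.
rewrite -cardsE.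
rewrite -cardsT; apply: leq_trans (leq_imset_card F _); apply: subset_leq_card.
apply/fintype.subsetP => -[f g]; rewrite !inE => /eqP /= E.
have ex i : exists j, g i == f j.
  by have [j ->] := factorial_sum_codom pV E i; exists j.
apply/imsetP; exists (f, [ffun i => xchoose (ex i)]) => //.
congr pair; apply/ffunP => i; rewrite !ffunE/=; exact/eqP/(xchooseP (ex i)).
Qed.

(** * A slowly growing exponent *)

Lemma leq_expnn p : p <= p ^ p.
Proof. by case: p => // p; rewrite -[leqLHS]expn1 leq_pexp2l. Qed.

Lemma exists_slow_growth : exists pp : nat -> nat,
  (forall V, 0 < V -> 0 < pp V /\ pp V ^ pp V <= V) /\
  (forall P, exists V0, forall V, V0 <= V -> P <= pp V).
Proof.
have exS V : exists p, p ^ p <= V.+1 by exists 1.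
have bd V p : p ^ p <= V.+1 -> p <= V.+1 by apply: leq_trans; exact: leq_expnn.
(* The largest [p] with [p ^ p <= V]; passing through [V.-1] keeps [p = 1] eligible at [V = 0]. *)
exists (fun V => ex_maxn (exS V.-1) (@bd V.-1)); split => [V V0|P].
  by case: ex_maxnP => p pV pmax; rewrite prednK// in pV pmax *; split => //; exact: pmax.
exists (P ^ P) => V PV; case: ex_maxnP => p _; apply.
exact: leq_trans (leqSpred _).
Qed.

Local Open Scope ring_scope.
Local Open Scope complex_scope.

Section ExponentialSums.
Variable R : realType.
Implicit Types (x alpha theta : R) (V M N p : nat).

(** * The character [e], roots of unity and orthogonality *)

Lemma eE x : e x = cos (2 * pi * x) +i* sin (2 * pi * x).
Proof. by rewrite /e /expC/= expR0 mul1r. Qed.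

Lemma e0 : e (0 : R) = 1.
Proof. by rewrite eE mulr0 cos0 sin0. Qed.

Lemma eD x y : e (x + y) = e x * e y.
Proof.
rewrite !eE mulrDr cosD sinD; apply/eqP; rewrite eq_complex/= eqxx/=.
by apply/eqP; ring.
Qed.

Lemma eN x : e (- x) = (e x)^*%C.
Proof. by rewrite !eE mulrN cosN sinN. Qed.

Lemma norm_e x : `|e x| = 1.
Proof. by rewrite normc_def eE/= cos2Dsin2 sqrtr1. Qed.

Lemma eMn x n : e (x *+ n) = e x ^+ n.
Proof. by elim: n => [|n IHn]; rewrite ?mulr0n ?e0// mulrSr eD IHn exprSr. Qed.

Lemma e_nat n : e (n%:R : R) = 1.
Proof.
by rewrite eMn eE mulr1 mulr_natl cos2pi sin2pi expr1n.
Qed.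

Lemma e_int (n : int) : e (n%:~R : R) = 1.
Proof. by case: n => n; rewrite ?NegzE ?mulrNz ?eN -?pmulrn e_nat// conjc1. Qed.

(** The real part is [1 - 2 * sin (pi * x) ^+ 2], and the sine is positive. *)
Lemma e_neq1 x : 0 < x < 1 -> e x != 1.
Proof.
move=> /andP[x0 x1]; rewrite eE eq_complex/= negb_and; apply/orP; left.
rewrite -mulrA mulr_natl cos_mulr2n cos2sin2.
have s0 : 0 < sin (pi * x).
  by apply: sin_gt0_pi; rewrite mulr_gt0 ?pi_gt0//= -[ltRHS]mulr1 ltr_pM2l ?pi_gt0.
rewrite -subr_eq0.
suff -> : (1 - sin (pi * x) ^+ 2) *+ 2 - 1 - 1 = - (sin (pi * x) ^+ 2 *+ 2).
  by rewrite oppr_eq0 mulrn_eq0/= sqrf_eq0 gt_eqF.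
by ring.
Qed.

(** The sign is that of [theta] in the sum: with [z] this root, [e (- M * (j / N) * k!)] is
    [(z ^+ j) ^+ (M * k!)]. *)
Lemma prim_root_eN (N : nat) : (0 < N)%N -> N.-primitive_root (e (- N%:R^-1 : R)).
Proof.
move=> N0; have NN0 : N%:R != 0 :> R by rewrite pnatr_eq0 -lt0n.
rewrite /primitive_root_of_unity N0/=; apply/forallP => -[i iN]/=.
apply/eqP; rewrite unity_rootE -eMn mulNrn eN.
have [->|neq] := eqVneq i.+1 N.
  by rewrite -[_^-1 *+ N]mulr_natr mulVf// (e_nat 1) conjc1 eqxx.
apply/negbTE; set x := _ *+ _.
suff : e x != 1 by apply: contra => /eqP h; rewrite -[e x]conjcK h conjc1.
rewrite /x; apply: e_neq1.
rewrite mulrn_wgt0 ?invr_gt0 ?ltr0n//=.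
rewrite -[_^-1 *+ _]mulr_natl ltr_pdivrMr ?ltr0n//.
by rewrite mul1r ltr_nat ltn_neqAle neq.
Qed.

(** A geometric sum whose ratio [x] satisfies [x ^+ N = 1]; since [a] and [b] are below [N], the
    ratio is 1 only if [a = b]. *)
Lemma sum_prim_root (N : nat) (z : R[i]) (a b : nat) :
    N.-primitive_root z -> `|z| = 1 -> (a < N)%N -> (b < N)%N ->
  \sum_(j < N) (z ^+ j) ^+ a * ((z ^+ j) ^+ b)^*%C = ((a == b) * N)%:R.
Proof.
move=> prz z1 aN bN.
pose x := z ^+ a * (z ^+ b)^*%C.
have zz n : z ^+ n * (z ^+ n)^*%C = 1.
  by rewrite -sqr_normc normrX z1 !expr1n.
rewrite (eq_bigr (fun j : 'I_N => x ^+ j)); last first.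
  by move=> j _; rewrite /x exprMn -rmorphXn/= ![_ ^+ j ^+ _]exprAC.
have [ab|neq] := eqVneq a b.
  rewrite /x ab (zz b) mul1n (eq_bigr (fun=> 1)) => [|j _]; last by rewrite expr1n.
  by rewrite sumr_const card_ord.
rewrite mul0n.
have xN : x ^+ N = 1.
  have zN n : (z ^+ n) ^+ N = 1 by rewrite exprAC (prim_expr_order prz) expr1n.
  by rewrite /x exprMn -rmorphXn/= !zN conjc1 mulr1.
have x1 : x - 1 != 0.
  apply: contra neq => /eqP x0.
  have : z ^+ a == z ^+ b.
    rewrite -[z ^+ a]mulr1 -(zz b) mulrCA -/x (eqP (_ : x == 1)) ?mulr1//.
    by rewrite -subr_eq0 x0.
  by rewrite (eq_prim_root_expr prz) !modn_small.
by apply: (mulfI x1); rewrite -subrX1 xN subrr mulr0.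
Qed.

(** After expanding the square, orthogonality leaves the pairs on which [f] agrees, each
    contributing a term of modulus [N]. *)
Lemma mean_square (I : finType) (N : nat) (z : R[i]) (c : I -> R[i]) (f : I -> nat) :
    N.-primitive_root z -> `|z| = 1 -> (forall i, `|c i| = 1) ->
    (forall i, (f i < N)%N) ->
  \sum_(j < N) `|\sum_i c i * (z ^+ j) ^+ f i| ^+ 2
    <= (N * #|[pred u : I * I | f u.1 == f u.2]|)%:R.
Proof.
move=> prz z1 c1 fN; rewrite -[leLHS]ger0_norm ?sumr_ge0//; last first.
  by move=> j _; rewrite exprn_ge0.
have -> : \sum_(j < N) `|\sum_i c i * (z ^+ j) ^+ f i| ^+ 2
    = \sum_(u : I * I) (c u.1 * (c u.2)^*%C) * ((f u.1 == f u.2) * N)%:R.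
  rewrite (eq_bigr (fun j : 'I_N => \sum_(u : I * I) (c u.1 * (c u.2)^*%C) *
      ((z ^+ j) ^+ f u.1 * ((z ^+ j) ^+ f u.2)^*%C))).
    rewrite exchange_big/=; apply: eq_bigr => u _.
    by rewrite -big_distrr/= sum_prim_root.
  move=> j _; rewrite sqr_normc rmorph_sum/= big_distrlr/= pair_big/=.
  by apply: eq_bigr => u _; rewrite rmorphM/= mulrACA.
have -> : \sum_(u : I * I) c u.1 * (c u.2)^*%C * ((f u.1 == f u.2) * N)%:R
   = \sum_(u : I * I | f u.1 == f u.2) c u.1 * (c u.2)^*%C * N%:R.
  rewrite [RHS]big_mkcond/=; apply: eq_bigr => u _.
  by case: ifP => _; rewrite ?mul1n// mul0n mulr0.
apply: le_trans (ler_norm_sum _ _ _) _.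
rewrite (eq_bigr (fun=> N%:R)) => [|u _]; last first.
  by rewrite !normrM norm_conjC !c1 !mul1r normr_nat.
by rewrite sumr_const natrM mulr_natr.
Qed.

(** * Moments of the exponential sum *)

Definition phase alpha theta M k : R :=
  k%:R * alpha - M%:R * (theta * k`!%:R).

Definition expsum V M alpha theta : R[i] :=
  \sum_(i < V) e (phase alpha theta M (V.+1 + i)).

(** The squared modulus as an element of [R], so that order and continuity in [theta] are handled
    over the reals. *)
Definition expsum_sq V M alpha theta : R :=
  complex.Re (expsum V M alpha theta) ^+ 2 + complex.Im (expsum V M alpha theta) ^+ 2.

Lemma expsum_sqE V M alpha theta :
  (expsum_sq V M alpha theta)%:C = `|expsum V M alpha theta| ^+ 2.
Proof. exact: add_Re2_Im2. Qed.

Lemma expsum_sq_ge0 V M alpha theta : 0 <= expsum_sq V M alpha theta.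
Proof. by rewrite addr_ge0 ?sqr_ge0. Qed.

(** The [p]-th power of the sum expands over [p]-tuples [f], with unimodular coefficients [c f] and
    exponents [n f]. The lower bound on [N] keeps these exponents below [N], so [mean_square] counts
    true equalities of factorial sums. *)
Lemma expsum_moment p V M N alpha : (p <= V)%N -> (0 < M)%N ->
    (p * (M * (2 * V)`!) < N)%N ->
  \sum_(j < N) expsum_sq V M alpha (j%:R / N%:R) ^+ p <= (N * (p ^ p * V ^ p))%:R.
Proof.
move=> pV M0 MN; have N0 : (0 < N)%N by exact: leq_ltn_trans MN.
pose z : R[i] := e (- N%:R^-1 : R).
rewrite -lecR rmorph_sum/= rmorph_nat.
pose c (f : {ffun 'I_p -> 'I_V}) : R[i] := \prod_i e ((V.+1 + f i)%:R * alpha).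
pose n (f : {ffun 'I_p -> 'I_V}) := (\sum_i M * (V.+1 + f i)`!)%N.
have -> : \sum_(j < N) (expsum_sq V M alpha (j%:R / N%:R) ^+ p)%:C
    = \sum_(j < N) `|\sum_f c f * (z ^+ j) ^+ n f| ^+ 2.
  apply: eq_bigr => j _; rewrite rmorphXn/= expsum_sqE -exprM mulnC exprM -normrX.
  congr (`|_| ^+ 2).
  pose t k : R[i] := e (k%:R * alpha) * (z ^+ j) ^+ (M * k`!).
  have tE k : e (phase alpha (j%:R / N%:R) M k) = t k.
    rewrite /phase /t /z -!eMn eD; congr (_ * e _).
    by rewrite -[RHS]mulr_natr -[- _ *+ j]mulr_natr natrM; ring.
  rewrite /expsum (eq_bigr (fun i : 'I_V => t (V.+1 + i)%N)) => [|i _]; last exact: tE.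
  rewrite -[in LHS](card_ord p) -prodr_const 
    (bigA_distr_bigA (fun (_ : 'I_p) (i : 'I_V) => t (V.+1 + i)%N)).
  by apply: eq_bigr => f _; rewrite big_split/= prodrXr.
have card_le : (#|[pred u : {ffun 'I_p -> 'I_V} * {ffun 'I_p -> 'I_V} | n u.1 == n u.2]|
    <= p ^ p * V ^ p)%N.
  apply: leq_trans (card_factorial_sum pV); rewrite subset_leq_card//.
  apply/fintype.subsetP => u; rewrite !inE /n -!big_distrr/=.
  by rewrite eqn_pmul2l.
apply: le_trans (mean_square _ _ _ _) _ => //.
- exact: prim_root_eN.
- exact: norm_e.
- by move=> f; rewrite normr_prod big1// => i _; rewrite norm_e.
- move=> f; apply: leq_ltn_trans MN.
  rewrite -[X in (X * _)%N]card_ord -sum_nat_const leq_sum// => i _.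
  by rewrite leq_mul2l; apply/orP; right; apply: leq_fact; rewrite mul2n -addnn addSnnS leq_add2l.
- by rewrite ler_nat leq_mul2l card_le orbT.
Qed.

(** * Markov's inequality: one [theta] for all [V] up to a bound *)

Lemma exists_le_mean (N : nat) (I : finType) (F : 'I_N -> I -> R) (A : I -> R) :
    (0 < N)%N -> (forall i, 0 < A i) -> (forall j i, 0 <= F j i) ->
    \sum_i (\sum_j F j i) / A i <= N%:R ->
  exists j, forall i, F j i <= A i.
Proof.
move=> N0 A0 F0 le.
(* Otherwise summing over [j] would exceed [N]. For this [j] each term, being nonnegative, is at
   most 1. *)
have [j jle] : exists j, \sum_i F j i / A i <= 1.
  apply: contrapT => /forallNP h; move: le; apply/negP; rewrite -ltNge.
  rewrite (eq_bigr (fun i => \sum_j F j i / A i)) => [|i _]; last by rewrite big_distrl.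
  rewrite exchange_big/= -{1}(card_ord N) -sumr_const.
  apply: ltr_sum => [|j _]; last by rewrite ltNge; apply/negP/h.
  by apply/hasP; exists (Ordinal N0) => //; rewrite mem_index_enum.
exists j => i; rewrite -[leRHS]mul1r -ler_pdivrMr//; apply: le_trans jle.
by rewrite (bigD1 i)//= lerDl sumr_ge0// => k _; rewrite divr_ge0// ltW.
Qed.

(** These telescoping weights split the exceptional proportion of [theta] among the [V], uniformly
    in [T]. *)
Lemma sum_inv_oblong_le1 (T : nat) :
  \sum_(V < T) ((V.+1 * V.+2)%:R^-1 : R) <= 1.
Proof.
suff -> : \sum_(V < T) ((V.+1 * V.+2)%:R^-1 : R) = 1 - T.+1%:R^-1.
  by rewrite lerBlDr lerDl invr_ge0 ler0n.
elim: T => [|T IHT]; first by rewrite big_ord0 invr1 subrr.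
rewrite big_ord_recr/= IHT natrM -[T.+2]addn1 -[T.+1]addn1 !natrD.
have T0 : 0 <= T%:R :> R by exact: ler0n.
by field; apply/andP; split; apply: lt0r_neq0; lra.
Qed.

Local Open Scope classical_set_scope.
Local Open Scope ring_scope.

(** With [p = pp V], the exponent [p + 8] is made of [p + 1] for the moment, as [p ^ p <= V], 5 for
    the number of triples [(M, r, b)], and 2 for the weight. *)
Definition good_at (L : nat) (pp : nat -> nat) V theta : Prop :=
  forall M r b, (0 < M <= L * V)%N -> (r < V ^ 2)%N -> (0 < b <= V ^ 2)%N ->
    expsum_sq V M (r%:R / b%:R) theta ^+ pp V <= (2 * L * V ^ (pp V + 8))%:R.

Lemma exists_good (L : nat) (pp : nat -> nat) (T : nat) : (0 < L)%N ->
    (forall V, (0 < V)%N -> (pp V ^ pp V <= V)%N) ->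
  exists theta, 0 <= theta <= 1 /\
    forall V, (0 < V <= T)%N -> good_at L pp V theta.
Proof.
move=> L0 hpp.
(* Large enough for [expsum_moment] at every [V.+1 <= T] and [M <= L * V.+1] simultaneously. *)
pose N := (\sum_(V < T) pp V.+1 * (L * V.+1 * (2 * V.+1)`!)).+1.
(* The triples [(M - 1, r, b - 1)], at [V.+1] in place of [V]. *)
pose I V : finType := ('I_(L * V.+1) * 'I_(V.+1 ^ 2) * 'I_(V.+1 ^ 2))%type.
pose F (j : 'I_N) (V : 'I_T) : R := \sum_(u : I V)
  expsum_sq V.+1 u.1.1.+1 (u.1.2%:R / u.2.+1%:R) (j%:R / N%:R) ^+ pp V.+1.
(* The moment bound times the number of triples, divided by the weight of [V.+1]. *)
pose A (V : 'I_T) : R := (L * V.+1 ^ (pp V.+1 + 6) * (V.+1 * V.+2))%:R.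
have A0 (V : 'I_T) : 0 < A V by rewrite ltr0n !muln_gt0 L0 expn_gt0.
have F0 j (V : 'I_T) : 0 <= F j V.
  by apply: sumr_ge0 => u _; rewrite exprn_ge0// expsum_sq_ge0.
have [||j jle] := exists_le_mean (F := F) (A := A) _ A0 F0; first by [].
  rewrite -[leRHS]mulr1; apply: le_trans (ler_wpM2l _ (sum_inv_oblong_le1 T)) => //.
  rewrite big_distrr/=; apply: ler_sum => V _.
  rewrite ler_pdivrMr// /F exchange_big/=.
  set p := pp V.+1.
  have pV : (p ^ p <= V.+1)%N by exact: hpp.
  have le u : (u \in predT) -> \sum_(j < N) expsum_sq V.+1 (u : I V).1.1.+1
      (u.1.2%:R / u.2.+1%:R) (j%:R / N%:R) ^+ p <= (N * (p ^ p * V.+1 ^ p))%:R :> R.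
    move=> _; apply: expsum_moment => //; first exact: leq_trans (leq_expnn _) pV.
    rewrite /N ltnS (bigD1 V)//= (leq_trans _ (leq_addr _ _))//.
    by rewrite leq_mul2l leq_mul2r ltn_ord !orbT.
  apply: le_trans (ler_sum _ le) _.
  rewrite sumr_const !card_prod !card_ord -mulrnA.
  have -> : N%:R / (V.+1 * V.+2)%:R * A V = (N * (L * V.+1 ^ (p + 6)))%:R.
    rewrite /A -/p [(N * _)%:R]natrM [(_ * (V.+1 * V.+2))%:R]natrM mulrACA.
    by rewrite mulVf ?mulr1// pnatr_eq0.
  rewrite ler_nat.
  have -> : (N * (p ^ p * V.+1 ^ p) * (L * V.+1 * V.+1 ^ 2 * V.+1 ^ 2) =
      N * (L * (V.+1 ^ (p + 5) * p ^ p)))%N by rewrite expnD; ring.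
  by rewrite !leq_mul2l (addnS p 5) (expnSr _ (p + 5)) leq_mul2l pV !orbT.
exists (j%:R / N%:R); split.
  by rewrite divr_ge0 ?ler0n//= ler_pdivrMr ?ltr0n// mul1r ler_nat ltnW.
case=> // V /= VT M r b /andP[M0 ML] rV /andP[b0 bV].
case: M M0 ML => // M _ ML; case: b b0 bV => // b _ bV.
have := jle (Ordinal VT); rewrite /F/= /A/=.
rewrite (bigD1 ((Ordinal ML, Ordinal rV), Ordinal bV))//= => le.
have {}le := le_trans _ le; apply: le_trans (le _ _) _.
  rewrite lerDl; apply: sumr_ge0 => u _; by rewrite exprn_ge0// expsum_sq_ge0.
rewrite ler_nat.
have -> : (2 * L * V.+1 ^ (pp V.+1 + 8) = L * V.+1 ^ (pp V.+1 + 6) * (V.+1 * (2 * V.+1)))%N.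
  by rewrite !expnD; ring.
by rewrite !leq_mul2l mul2n -addnn addSnnS leq_addl !orbT.
Qed.

(** * Compactness: one [theta] for all [V] *)

Lemma continuous_expsum_sq V M alpha : continuous (expsum_sq V M alpha : R -> R).
Proof.
have ReE theta : complex.Re (expsum V M alpha theta) =
    \sum_(i < V) cos (2 * pi * phase alpha theta M (V.+1 + i)).
  by rewrite /expsum raddf_sum; apply: eq_bigr => i _; rewrite eE.
have ImE theta : complex.Im (expsum V M alpha theta) =
    \sum_(i < V) sin (2 * pi * phase alpha theta M (V.+1 + i)).
  by rewrite /expsum raddf_sum; apply: eq_bigr => i _; rewrite eE.
have cphase k : continuous (fun theta => 2 * pi * phase alpha theta M k).
  move=> x; apply: cvgMr => /=; apply: cvgB; first exact: cvg_cst.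
  by apply: cvgMr; apply: cvgMl; exact: cvg_id.
have cre : continuous (fun theta => complex.Re (expsum V M alpha theta)).
  under [X in continuous X]funext do rewrite ReE.
  move=> x; apply: (cvg_big (op := +%R)) => [|i _]; first exact: add_continuous.
  exact: (continuous_comp (cphase _ _) (@continuous_cos R _)).
have cim : continuous (fun theta => complex.Im (expsum V M alpha theta)).
  under [X in continuous X]funext do rewrite ImE.
  move=> x; apply: (cvg_big (op := +%R)) => [|i _]; first exact: add_continuous.
  exact: (continuous_comp (cphase _ _) (@continuous_sin R _)).
move=> x; apply: cvgD; rewrite expr2; apply: cvgM; by [exact: cre|exact: cim].
Qed.

Lemma closed_good_at (L : nat) (pp : nat -> nat) V :
  closed (good_at L pp V : set R).
Proof.
have -> : good_at L pp V =
  \bigcap_(u in [set u : nat * nat * nat | [/\ (0 < u.1.1 <= L * V)%N,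
      (u.1.2 < V ^ 2)%N & (0 < u.2 <= V ^ 2)%N]])
    [set theta : R | expsum_sq V u.1.1 (u.1.2%:R / u.2%:R) theta ^+ pp V
      <= (2 * L * V ^ (pp V + 8))%:R].
  apply/seteqP; split => [theta h [[M r] b] [hM hr hb]|theta h M r b hM hr hb].
    exact: h.
  exact: (h (M, r, b)).
apply: closed_bigI => u _.
apply: (preimage_closed (f := fun theta => expsum_sq V u.1.1 (u.1.2%:R / u.2%:R) theta ^+ pp V)
  _ (@closed_le R _)) => x _.
exact: (continuous_comp (@continuous_expsum_sq _ _ _ _) (@exprn_continuous R _ _)).
Qed.

(** For fixed [V] the closed set [good_at L pp V] contains [th T] for all [T >= V], hence also every
    cluster point of [th]; compactness of [[0, 1]] provides one. *)
Lemma exists_good_all (L : nat) (pp : nat -> nat) : (0 < L)%N ->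
    (forall V, (0 < V)%N -> (pp V ^ pp V <= V)%N) ->
  exists theta, forall V, (0 < V)%N -> good_at L pp V theta.
Proof.
move=> L0 hpp.
have /choice[th thP] := fun T => exists_good T L0 hpp.
have th01 : (th @ \oo) [set` `[0, 1]].
  by exists 0%N => // T _; rewrite /= in_itv/=; case: (thP T).
have [theta [_ cl]] := @segment_compact R 0 1 (th @ \oo) _ th01.
exists theta => V V0.
move: cl; rewrite clusterE => /(_ (good_at L pp V)) cl.
apply: (closed_good_at (L := L) (pp := pp) (V := V)); apply: cl.
exists V => // T /= VT; have [_] := thP T; by apply; rewrite V0.
Qed.

(** * Pointwise bounds and reduction of the frequency modulo 1 *)

Lemma expsum_le V M (alpha theta : R) : `|expsum V M alpha theta| <= V%:R.
Proof.
rewrite (le_trans (ler_norm_sum _ _ _))// (eq_bigr (fun=> 1)) => [|i _]; last by rewrite norm_e.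
by rewrite sumr_const card_ord.
Qed.

(** Compare [2p]-th powers, [p = pp V]: the right side has [V] to the power [p + 2 * p * eta], which
    is at least [p + 8], and [2 * L] is at most its own [2p]-th power. *)
Lemma good_at_expsum_le L pp V M r b (theta eta : R) :
    (0 < L)%N -> (0 < V)%N -> (0 < pp V)%N -> 4 <= (pp V)%:R * eta ->
    good_at L pp V theta ->
    (0 < M <= L * V)%N -> (r < V ^ 2)%N -> (0 < b <= V ^ 2)%N ->
  `|expsum V M (r%:R / b%:R) theta| <= ((2 * L)%:R * V%:R `^ (1 / 2 + eta))%:C.
Proof.
move=> L0 V0 p0 p4 good hM hr hb.
have V1 : 1 <= V%:R :> R by rewrite ler1n.
have L1 : 1 <= (2 * L)%:R :> R by rewrite ler1n muln_gt0.
rewrite normc_def lecR -/(expsum_sq V M (r%:R / b%:R) theta).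
have pp2 : (0 < 2 * pp V)%N by rewrite muln_gt0.
rewrite -(ler_pXn2r pp2) ?nnegrE ?sqrtr_ge0 ?mulr_ge0 ?powR_ge0//.
rewrite [leLHS]exprM sqr_sqrtr ?expsum_sq_ge0//.
apply: le_trans (good M r b hM hr hb) _.
rewrite natrM exprMn ler_pM//; first by rewrite ler_eXnr.
rewrite -powR_mulrn ?powR_ge0// -powRrM natrX -powR_mulrn//.
by apply: ler_powR => //; rewrite natrD natrM; lra.
Qed.

(** The integer part of [A / b], multiplied by [k], changes the phase by an integer, invisible to
    [e]. *)
Lemma expsum_reduce V M (A : int) b (theta : R) : (0 < b)%N ->
  exists2 r, (r < b)%N & expsum V M (A%:~R / b%:R) theta = expsum V M (r%:R / b%:R) theta.
Proof.
move=> b0; have bN0 : b%:R != 0 :> R by rewrite pnatr_eq0 -lt0n.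
exists `|(A %% b)%Z|%N.
  by rewrite -ltz_nat gez0_abs ?modz_ge0 ?ltz_pmod// -lt0n.
apply: eq_bigr => i _; rewrite /phase.
have -> : A%:~R / b%:R = (A %/ b)%Z%:~R + `|(A %% b)%Z|%:R / b%:R :> R.
  rewrite {1}(divz_eq A b) intrD intrM mulrDl -pmulrn mulfK//; congr (_ + _ / _).
  by rewrite natr_absz ger0_norm// modz_ge0// -lt0n.
by rewrite mulrDr -addrA eD [X in X * _%:~R]pmulrn -intrM e_int mul1r.
Qed.

End ExponentialSums.

(** * From the vectors [m] and [q] to a single frequency *)

Unset Implicit Arguments.

Theorem theorem3p2 (R : realType) (d : nat) (hd : (1 <= d)%N)
    (K : R) (hK : 0 < K) :
  exists theta : R, let a := fun k : nat => theta * (k`!)%:R in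
    forall eta : R, 0 < eta ->
    exists2 C : R, 0 < C &
    forall (V : nat) (m : 'rV[nat]_d) (q : 'rV[rat]_d),
      (1 <= V)%N ->
      (forall i : 'I_d, (m 0 i)%:Z <= Num.floor (K * V%:R)) -> m <> 0 ->
      D1 V q ->
      `| \sum_(V.+1 <= k < (2 * V).+1)
           e (dot (map_mx (fun n : nat => n%:R) m)
                  (k%:R *: map_mx ratr q - a k *: const_mx 1)) |
        <= (C * V%:R `^ (1 / 2 + eta))%:C.
Proof.
have [pp [hpp pp_lim]] := exists_slow_growth.
(* Each of the [d] entries of [m] is at most [K * V], so their sum is at most [L * V]. *)
pose L := (d * Num.bound K)%N.
have KB : K < (Num.bound K)%:R by apply: archi_boundP; exact: ltW.
have L0 : (0 < L)%N by rewrite muln_gt0 hd -(ltr0n R) (lt_trans hK).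
have [theta th] := @exists_good_all R L pp L0 (fun V V0 => (hpp V V0).2).
exists theta => a eta eta0.
(* From [V0] on, [pp V * eta >= 4]. *)
have [V0 hV0] := pp_lim (Num.bound (4 / eta)).
(* The first summand serves [V >= V0]; the second covers smaller [V] by the trivial bound [V]. *)
exists ((2 * L)%:R + V0%:R).
  by rewrite ltr_wpDr ?ler0n// ltr0n muln_gt0.
move=> V m q V1 mV m0 [_ dV].
pose M := (\sum_i m 0%R i)%N.
have M0 : (0 < M)%N.
  rewrite lt0n; apply/negP; rewrite sum_nat_eq0 => /forallP h; apply: m0.
  by apply/rowP => i; rewrite mxE; apply/eqP/h.
have ML : (M <= L * V)%N.
  rewrite -mulnA -{1}[d]card_ord -sum_nat_const leq_sum// => i _.
  rewrite -(ler_nat R) natrM; have := mV i; rewrite floor_ge_int => h.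
  by rewrite (le_trans h)// ler_wpM2r// ltW.
have [A [b0 _ qE]] := denP q.
set b := den q in dV b0 qE.
(* The numerator of [m . q] over the common denominator [b]. *)
pose B : int := \sum_i (m 0 i)%:Z * A 0 i.
have -> : \sum_(V.+1 <= k < (2 * V).+1)
     e (dot (map_mx (fun n : nat => n%:R) m)
            (k%:R *: map_mx ratr q - a k *: const_mx 1))
   = expsum V M (B%:~R / b%:R) theta.
  rewrite -{1}[V.+1]add0n big_addn subSS mul2n -addnn addnK big_mkord.
  apply: eq_bigr => i _; rewrite [(i + _)%N]addnC; congr e.
  move: (V.+1 + i)%N => k; rewrite /dot /phase /B /M natr_sum rmorph_sum/=.
  rewrite !mulr_suml mulr_sumr -sumrB; apply: eq_bigr => j _.
  rewrite !mxE qE fmorph_div/= ratr_int ratr_nat /a intrM -pmulrn.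
  by ring.
have [r rb ->] := @expsum_reduce R V M B b theta b0.
have le1 : 1 <= V%:R `^ (1 / 2 + eta) :> R.
  by rewrite -[leLHS](powRr0 V%:R) ler_powR ?ler1n//; lra.
have [V0V|VV0] := leqP V0 V.
  apply: le_trans (@good_at_expsum_le R L pp V M r b theta eta _ _ _ _ _ _ _ _) _ => //.
  - exact: (hpp V V1).1.
  - rewrite -ler_pdivrMr// (le_trans (ltW (archi_boundP _)))// ?ler_nat ?hV0//.
    by rewrite divr_ge0// ltW.
  - exact: th.
  - by rewrite M0.
  - exact: leq_trans dV.
  - by rewrite b0.
  by rewrite lecR ler_wpM2r ?powR_ge0// lerDl.
apply: le_trans (@expsum_le _ _ _ _ _) _.
rewrite -(rmorph_nat (real_complex R)) lecR -[leLHS]mulr1 ler_pM//.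
by rewrite (@le_trans _ _ V0%:R)// ?ler_nat 1?ltnW// lerDr.
Qed.
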